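(* Let $d\ge 1$, let $\mathbb{Z}^d$ be equipped with a connection $\mathcal{C}$ satisfying conditions (C1)–(C3) of the context, and let $n\in\mathbb{N}$. Then the operators $L_n$, $U_n$, $U_n\circ L_n$, $L_n\circ U_n$ on $\mathcal{A}(\mathbb{Z}^d)$ form a semi-group with respect to composition (the set of these operators is closed under composition), with the following composition table, where the entry in row $P$ and column $Q$ is $P\circ Q$: $$\begin{array}{c||c|c|c|c} & L_n & U_n & U_n\circ L_n & L_n\circ U_n\\ \hline L_n & L_n & L_n\circ U_n & U_n\circ L_n & L_n\circ U_n\\ U_n & U_n\circ L_n & U_n & U_n\circ L_n & L_n\circ U_n\\ U_n\circ L_n & U_n\circ L_n & L_n\circ U_n & U_n\circ L_n & L_n\circ U_n\\ L_n\circ U_n & U_n\circ L_n & L_n\circ U_n & U_n\circ L_n & L_n\circ U_n \end{array}$$ Furthermore, this semi-group is totally ordered with respect to the pointwise order of operators: $$L_n\le U_n\circ L_n\le L_n\circ U_n\le U_n .$$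
   Context: $\mathbb{N}=\{1,2,\dots\}$. $\mathcal{A}(\mathbb{Z}^d)$ is the vector lattice of all functions $f:\mathbb{Z}^d\to\mathbb{R}$ with pointwise operations and order. For operators $P,Q$ on $\mathcal{A}(\mathbb{Z}^d)$, $P\le Q$ means $P(f)\le Q(f)$ for all $f\in\mathcal{A}(\mathbb{Z}^d)$. A connection on a non-empty set $B$ is a family $\mathcal{C}$ of subsets of $B$ such that (i) $\emptyset\in\mathcal{C}$; (ii) $\{x\}\in\mathcal{C}$ for all $x\in B$; (iii) for any family $\{C_i:i\in I\}\subseteq\mathcal{C}$, $\bigcap_{i\in I} C_i\neq\emptyset$ implies $\bigcup_{i\in I} C_i\in\mathcal{C}$. Members of $\mathcal{C}$ are called connected sets. Standing assumptions on the connection $\mathcal{C}$ on $\mathbb{Z}^d$: (C1) $\mathbb{Z}^d\in\mathcal{C}$; (C2) for every $C\in\mathcal{C}$ and $a\in\mathbb{Z}^d$, the translate $\{x+a:x\in C\}$ is in $\mathcal{C}$; (C3) if $V\subsetneq W$ with $V,W\in\mathcal{C}$, then there exists $x\in W\setminus V$ with $V\cup\{x\}\in\mathcal{C}$. For $x\in\mathbb{Z}^d$ and $n\in\mathbb{N}$ let $\mathcal{N}_n(x)=\{V\in\mathcal{C}: x\in V,\ \mathrm{card}(V)=n+1\}$. For $f\in\mathcal{A}(\mathbb{Z}^d)$: $$L_n(f)(x)=\max_{V\in\mathcal{N}_n(x)}\min_{y\in V}f(y),\qquad U_n(f)(x)=\min_{V\in\mathcal{N}_n(x)}\max_{y\in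 V}f(y).$$
   Formalization: The outer max and min over N_n(x) in the definitions of L_n and U_n are read as supremum and infimum, since N_n(x) may be infinite (e.g. when all subsets are connected) and the max or min need not exist; they agree whenever it does. *)

(* Defs.v *)
From mathcomp Require Export all_boot all_order all_algebra.
From mathcomp Require Export all_classical all_reals.

Set Implicit Arguments.
Unset Strict Implicit.
Unset Printing Implicit Defensive.

Import Order.TTheory GRing.Theory Num.Theory.
Local Open Scope classical_set_scope.
Local Open Scope ring_scope.

Record is_connection (B : Type) (C : set (set B)) : Prop := IsConnection {
  connection_nonempty : [set: B] !=set0;
  connection_set0 : C set0;
  connection_set1 : forall x : B, C [set x];
  (* a family of members of C is given by the subset D of C it forms; for D
     empty the intersection is B, the union is set0, and the clause reduces
     to connection_set0 *)
  connection_bigcup : forall D : set (set B), D `<=` C ->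
    \bigcap_(A in D) A !=set0 -> C (\bigcup_(A in D) A)
}.

Notation lattice_points d := 'rV[int]_d.

(* A(Z^d). Both (<=)%O on A(Z^d) and (<=)%O on operators A(Z^d) -> A(Z^d) are
   the library's pointwise order on functions, so that (P <= Q)%O means
   forall f x, P f x <= Q f x; see lefP. *)
Notation lattice_fun R d := (lattice_points d -> R).

Notation lattice_op R d := (lattice_fun R d -> lattice_fun R d).

Definition translation_invariant d (C : set (set (lattice_points d))) : Prop :=
  forall (V : set (lattice_points d)) (a : lattice_points d),
    C V -> C [set x + a | x in V].

Definition one_point_extension d (C : set (set (lattice_points d))) : Prop :=
  forall V W : set (lattice_points d), C V -> C W -> V `<` W ->
    exists2 x, (W `\` V) x & C (V `|` [set x]).

Definition neighborhoods d (C : set (set (lattice_points d))) (n : nat)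
    (x : lattice_points d) : set (set (lattice_points d)) :=
  [set V | [/\ C V, V x & (V #= `I_n.+1)%card]].

(* Each V in neighborhoods C n x is finite and nonempty, so the inner inf (resp.
   sup) is a minimum (resp. maximum). The outer extremum is taken over a family
   that the assumptions on C do not force to be finite (C may be all subsets),
   so that it need not be attained; it is a sup of a nonempty set bounded above
   by f x (resp. an inf of a nonempty set bounded below by f x), hence a genuine
   least upper (resp. greatest lower) bound, equal to the max (resp. min)
   whenever the latter exists. *)
Definition lulu_L (R : realType) d (C : set (set (lattice_points d))) (n : nat)
    : lattice_op R d :=
  fun f x => sup [set inf [set f y | y in V] | V in neighborhoods C n x].

Definition lulu_U (R : realType) d (C : set (set (lattice_points d))) (n : nat)
    : lattice_op R d :=
  fun f x => inf [set sup [set f y | y in V] | V in neighborhoods C n x].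

Definition is_semigroup (T : Type) (op : T -> T -> T) (S : set T) : Prop :=
  (forall P Q, S P -> S Q -> S (op P Q)) /\
  (forall P Q Q', S P -> S Q -> S Q' -> op P (op Q Q') = op (op P Q) Q').

(* Main.v *)
(** L is the opening that replaces each strict superlevel set {f > t} by the
union of the connected sets of n + 1 points it contains, and U f = - L (- f).
Hence L <= id <= U, and L and U are idempotent. The main point is UL <= LU,
which is a statement about a single level set, proved by joining a connected
component to a connected set of n + 1 points adjacent to it. Applied to L f and
U f, this inequality gives LUL = UL and ULU = LU, which with idempotence
determine the whole table. *)

Require Import Defs.

Set Implicit Arguments.
Unset Strict Implicit.
Unset Printing Implicit Defensive.

Import Order.TTheory GRing.Theory Num.Theory.

Local Open Scope classical_set_scope.
Local Open Scope ring_scope.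

(** * Minima over finite sets *)

Lemma finite_set_argmin (T : Type) disp (T' : orderType disp) (f : T -> T')
    (V : set T) :
  finite_set V -> V !=set0 ->
  exists2 y0, V y0 & forall y, V y -> (f y0 <= f y)%O.
Proof.
move=> /finite_setP[n]; elim: n V => [|n IHn] V.
  by rewrite II0 card_eq0 => /eqP -> [].
move=> /eq_cardSP[x Vx cardVx] _.
have [Vx0|/set0P/(IHn _ cardVx)[y [Vy _] ymin]] := eqVneq (V `\ x) set0.
  exists x => // y Vy; have [->//|yx] := pselect (y = x).
  by have : (V `\ x) y by []; rewrite Vx0.
exists (if (f x <= f y)%O then x else y) => [|z Vz]; first by case: ifP.
have [->|zx] := pselect (z = x); first by case: (leP (f x) (f y)) => [|/ltW].
have yz : (f y <= f z)%O by exact: ymin.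
by case: (leP (f x) (f y)) => [xy|//]; exact: le_trans xy yz.
Qed.

(** The infimum over a finite nonempty set is attained, which keeps the inequality strict. *)
Lemma lt_inf_image (R : realType) (T : Type) (f : T -> R) (V : set T) (t : R) :
  finite_set V -> V !=set0 ->
  t < inf [set f y | y in V] <-> (forall y, V y -> t < f y).
Proof.
move=> finV V0; have [y0 Vy0 y0min] := finite_set_argmin f finV V0.
have lbf : lbound [set f y | y in V] (f y0) by move=> _ [y Vy <-]; exact: y0min.
split=> [tV y Vy|/(_ _ Vy0) tf].
  by apply: lt_le_trans tV _; apply: ge_inf; [exists (f y0)|exists y].
by apply: lt_le_trans tf _; apply: lb_le_inf => //; exists (f y0), y0.
Qed.

(** * Connected components *)

Section Connection.
Variables (B : Type) (C : set (set B)).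
Hypothesis hC : is_connection C.

Lemma connectionU (V W : set B) :
  C V -> C W -> V `&` W !=set0 -> C (V `|` W).
Proof.
move=> CV CW [x [Vx Wx]].
have -> : V `|` W = \bigcup_(A in [set V; W]) A.
  by rewrite bigcup_setU !bigcup_set1.
apply: (connection_bigcup hC) => [A [->|->]//|].
by exists x => A [->|->].
Qed.

Definition connection_component (A : set B) (x : B) : set B :=
  \bigcup_(V in [set V | [/\ C V, V x & V `<=` A]]) V.

Lemma connection_component_connected A x : C (connection_component A x).
Proof.
apply: (connection_bigcup hC) => [V []//|].
by exists x => V [].
Qed.

Lemma connection_component_sub A x : connection_component A x `<=` A.
Proof. by move=> y [V [_ _ VA] Vy]; exact: VA. Qed.

Lemma connection_component_refl (A : set B) x :
  A x -> connection_component A x x.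
Proof.
move=> Ax; exists [set x] => //; split=> //; last by move=> _ ->.
exact: (connection_set1 hC).
Qed.

(** The union of the component and [V] is itself one of the sets whose union defines the
    component. *)
Lemma connection_component_max (A V : set B) x : A x -> C V -> V `<=` A ->
  connection_component A x `&` V !=set0 -> V `<=` connection_component A x.
Proof.
move=> Ax CV VA meet y Vy.
exists (connection_component A x `|` V); last by right.
split; last by rewrite subUset; split=> //; exact: connection_component_sub.
- by apply: connectionU => //; exact: connection_component_connected.
- by left; exact: connection_component_refl.
Qed.

End Connection.

(** * Connected sets of n + 1 lattice points *)

Section LatticeConnection.
Variables (d : nat) (C : set (set (lattice_points d))).
Hypothesis hd : (1 <= d)%N.
Hypothesis hC : is_connection C.
Hypothesis C1 : C [set: lattice_points d].
Hypothesis C3 : one_point_extension C.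

(** The constant vectors are pairwise distinct once there is at least one coordinate. *)
Lemma lattice_pointsT_card_ge n : (`I_n #<= [set: lattice_points d])%card.
Proof.
case: d hd => // d' _.
pose f k : lattice_points d'.+1 := const_mx k%:Z.
have f_inj : injective f.
  by move=> i j /matrixP/(_ ord0 ord0); rewrite !mxE => -[].
have fI : (f @` `I_n #= `I_n)%card.
  by apply: inj_card_eq => i j _ _; exact: f_inj.
by rewrite -(card_le_eql fI); exact: subset_card_le.
Qed.

(** [C3] grows the singleton of [x] inside [W], one point at a time. *)
Lemma neighborhoods_sub_exists n (W : set (lattice_points d)) x :
  C W -> W x -> (`I_n.+1 #<= W)%card ->
  exists2 V, neighborhoods C n x V & V `<=` W.
Proof.
move=> CW Wx; elim: n => [_|n IHn leW].
  exists [set x]; last by move=> _ ->.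
  by split=> //; [exact: (connection_set1 hC)|exact: card_set1].
have [|V [CV Vx cardV] VW] := IHn.
  by apply: card_le_trans leW; rewrite card_le_II.
have [|y [Wy Vy] CVy] := C3 CV CW.
  rewrite properEneq; split=> //; apply/eqP => VW'.
  (* If [V] were all of [W], then [W] would have n + 1 points instead of at least n + 2. *)
  by move: leW; rewrite -VW' (card_le_eqr cardV) card_le_II ltnn.
exists (V `|` [set y]); last by rewrite subUset; split=> // _ ->.
split=> //; first by left.
apply/eq_cardSP; exists y; first by right.
by rewrite setUDK // => z [->].
Qed.

Lemma neighborhoods_nonempty n x : neighborhoods C n x !=set0.
Proof.
have [||V NV _] := @neighborhoods_sub_exists n setT x C1; first by [].
  exact: lattice_pointsT_card_ge.
by exists V.
Qed.

Definition connected_opening n (A : set (lattice_points d)) :=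
  [set x | exists2 V, neighborhoods C n x V & V `<=` A].

Lemma neighborhoods_center n x y V :
  neighborhoods C n x V -> V y -> neighborhoods C n y V.
Proof. by move=> [CV _ cardV] Vy; split. Qed.

(* This is the inequality UL <= LU for indicator functions. When x lies
   outside G, the opening of A, the component K of x in the complement of G
   cannot contain n + 1 points, so no neighborhood of a point of K avoids A; one
   point added to K by C3 falls in G, and joins K to n + 1 points of A. *)
Lemma connected_opening_closing n (A : set (lattice_points d)) x :
  (forall V, neighborhoods C n x V -> V `&` connected_opening n A !=set0) ->
  exists2 V, neighborhoods C n x V &
    forall y W, V y -> neighborhoods C n y W -> W `&` A !=set0.
Proof.
set G := connected_opening n A => meetG.
have GA : G `<=` A by move=> y [V [_ Vy _] VA]; exact: VA.
have [[V NV VA]|nGx] := pselect (G x).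
  exists V => // y W Vy [_ Wy _]; exists y; split=> //; exact: VA.
pose K := connection_component C (~` G) x.
have CK : C K by exact: connection_component_connected.
have Kx : K x by exact: connection_component_refl.
have KG : K `<=` ~` G by exact: connection_component_sub.
have [V0 NV0] := neighborhoods_nonempty n x.
have [g [_ Gg]] := meetG _ NV0.
have [|y [_ Ky] CKy] := C3 CK C1.
  by rewrite properEneq; split=> //; apply/eqP => KT; apply: (KG g) => //; rewrite KT.
have Gy : G y.
  apply: contrapT => nGy; apply: Ky.
  suff : K `|` [set y] `<=` K by apply; right.
  apply: connection_component_max => //.
    by rewrite subUset; split=> // _ ->.
  by exists x; split=> //; left.
have [W [CW Wy cardW] WA] := Gy.
have CKW : C (K `|` W).
  have -> : K `|` W = (K `|` [set y]) `|` W.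
    by rewrite -setUA (setUidr (_ : [set y] `<=` W)) // => _ ->.
  by apply: connectionU => //; exists y; split=> //; right.
(* [K] alone may have too few points; [W] guarantees n + 1 of them. *)
have [||V NV VKW] := neighborhoods_sub_exists (n := n) (x := x) CKW.
- by left.
- by rewrite -(card_le_eql cardW); apply: subset_card_le => z Wz; right.
exists V => // z V' /VKW[Kz|Wz] [CV' V'z cardV']; last first.
  by exists z; split=> //; exact: WA.
apply: contrapT => V'A.
have V'K : V' `<=` K.
  apply: connection_component_max => //; last by exists z.
  by move=> w V'w Gw; apply: V'A; exists w; split=> //; exact: GA.
(* If [K] contained the n + 1 points of [V'], it would contain a neighborhood of [x], which misses
   [G] and contradicts [meetG]. *)
have [|V'' NV'' V''K] := neighborhoods_sub_exists (n := n) CK Kx.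
  by rewrite -(card_le_eql cardV'); exact: subset_card_le.
by have [w [/V''K/KG]] := meetG _ NV''.
Qed.

(** * The operators through their strict level sets *)

Section Operators.
Variables (R : realType) (n : nat).
Local Notation L := (lulu_L C n : lattice_op R d).
Local Notation U := (lulu_U C n : lattice_op R d).

(** Strict levels suit a supremum that need not be attained: a number below it lies below some
    member of the family. *)
Lemma lt_lulu_L (f : lattice_fun R d) x t :
  t < L f x <-> connected_opening n [set y | t < f y] x.
Proof.
have lt_inf V u : neighborhoods C n x V ->
    u < inf [set f y | y in V] <-> V `<=` [set y | u < f y].
  move=> [_ Vx cardV]; apply: lt_inf_image; last by exists x.
  by apply/finite_setP; exists n.+1.
split=> [/sup_gt[]|[V NV Vt]].
- by have [V NV] := neighborhoods_nonempty n x; exists (inf [set f y | y in V]), V.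
- by move=> _ [V NV <-] /(lt_inf _ _ NV) Vt; exists V.
- apply: (@lt_le_trans _ _ (inf [set f y | y in V])); first exact/lt_inf.
  apply: ub_le_sup; last by exists V.
  (* Boundedness must be checked, since [sup] has a default value on unbounded sets; each inner
     minimum is at most [f x] because [x] lies in [W]. *)
  exists (f x) => _ [W NW <-]; apply: lt_le => u /(lt_inf _ _ NW); apply.
  by case: NW.
Qed.

(** By definition [inf] is minus the [sup] of the opposite set, so unfolding both extrema
    suffices. *)
Lemma lulu_U_dual (f : lattice_fun R d) : U f = - L (- f).
Proof.
apply/funext => x; rewrite /lulu_U /lulu_L /inf fctE; congr (- sup _).
rewrite image_comp; apply: eq_imagel => V _ /=; congr (- sup _).
by rewrite image_comp; apply: eq_imagel => y _ /=; rewrite fctE opprK.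
Qed.

Lemma lulu_L_le_id (f : lattice_fun R d) x : L f x <= f x.
Proof. by apply: lt_le => t /lt_lulu_L[V [_ Vx _]]; apply. Qed.

(** A set [V] witnessing t < L f x is a neighborhood of each of its points, so it witnesses t < L f
    y for all [y] in [V]. *)
Lemma lulu_LL (f : lattice_fun R d) : L (L f) = L f.
Proof.
apply/funext => x; apply/eqP; rewrite eq_le lulu_L_le_id /=.
apply: lt_le => t /lt_lulu_L[V NV Vf]; apply/lt_lulu_L.
exists V => // y Vy; apply/lt_lulu_L; exists V => //.
exact: neighborhoods_center NV Vy.
Qed.

Lemma id_le_lulu_U (f : lattice_fun R d) x : f x <= U f x.
Proof. by rewrite lulu_U_dual !fctE lerNr; exact: lulu_L_le_id. Qed.

Lemma lulu_UU (f : lattice_fun R d) : U (U f) = U f.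
Proof. by rewrite !lulu_U_dual opprK lulu_LL. Qed.

Lemma lulu_U_lt (f : lattice_fun R d) x t :
  U f x < t <-> connected_opening n [set y | f y < t] x.
Proof.
rewrite lulu_U_dual !fctE ltrNl lt_lulu_L.
suff -> : [set y | - t < (- f) y] = [set y | f y < t] by [].
by apply/funext => y /=; rewrite !fctE ltrN2.
Qed.

(** The converse can fail, as the outer infimum need not be attained. *)
Lemma lulu_U_le (f : lattice_fun R d) x t V :
  neighborhoods C n x V -> (forall y, V y -> f y <= t) -> U f x <= t.
Proof.
move=> NV Vt; apply/le_ltP => u tu; apply/lulu_U_lt.
by exists V => // y /Vt fyt; exact: le_lt_trans fyt tu.
Qed.

Lemma lulu_UL_le_LU (f : lattice_fun R d) x : U (L f) x <= L (U f) x.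
Proof.
(* The extrema need not be attained: the level s strictly between t and
   U (L f) x lets the strict inequalities survive the passage to sup and inf. *)
apply: lt_le => t tULf; pose s := (t + U (L f) x) / 2.
have [ts sULf] : t < s /\ s < U (L f) x by rewrite !midf_lt.
have [V NV|V NV VA] := @connected_opening_closing n [set y | s < f y] x.
  (* If [V] missed the opening of {f > s}, then L f <= s on [V], hence U (L f) x <= s. *)
  apply: contrapT => meet; move: sULf; apply/negP; rewrite -leNgt.
  apply: lulu_U_le NV _ => y Vy; rewrite leNgt; apply/negP => /lt_lulu_L sLf.
  by apply: meet; exists y.
apply/lt_lulu_L; exists V => // y Vy; apply: lt_le_trans ts _.
(* U f y < s would give a neighborhood of [y] on which f < s, whereas every neighborhood of [y]
   meets {f > s}. *)
rewrite leNgt; apply/negP => /lulu_U_lt[W NW Ws].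
have [z [/Ws /= fz]] := VA _ _ Vy NW.
by rewrite /= ltNge (ltW fz).
Qed.
End Operators.
End LatticeConnection.

(** * Composition table and total order *)

Theorem mainTheorem2 (R : realType) (d : nat) (hd : (1 <= d)%N)
    (C : set (set (lattice_points d)))
    (hC : is_connection C)
    (C1 : C [set: lattice_points d])
    (C2 : translation_invariant C)
    (C3 : one_point_extension C)
    (n : nat) (hn : (1 <= n)%N) :
  let L : lattice_op R d := lulu_L C n in
  let U : lattice_op R d := lulu_U C n in
  let UL : lattice_op R d := U \o L in
  let LU : lattice_op R d := L \o U in
  let S : set (lattice_op R d) := [set L; U; UL; LU] in
  is_semigroup (fun P Q : lattice_op R d => P \o Q) S /\
  [/\ [/\ L  \o L = L,  L  \o U = LU, L  \o UL = UL & L  \o LU = LU],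
      [/\ U  \o L = UL, U  \o U = U,  U  \o UL = UL & U  \o LU = LU],
      [/\ UL \o L = UL, UL \o U = LU, UL \o UL = UL & UL \o LU = LU] &
      [/\ LU \o L = UL, LU \o U = LU, LU \o UL = UL & LU \o LU = LU] ] /\
  total_on S (fun P Q : lattice_op R d => (P <= Q)%O) /\
  [/\ (L <= UL)%O, (UL <= LU)%O & (LU <= U)%O].
Proof.
move=> L U UL LU S.
have L_id (f : lattice_fun R d) x : L f x <= f x by exact: lulu_L_le_id.
have U_id (f : lattice_fun R d) x : f x <= U f x by exact: id_le_lulu_U.
have ULLU (f : lattice_fun R d) x : U (L f) x <= L (U f) x.
  exact: lulu_UL_le_LU.
have LLE : L \o L = L by apply/funext => f; exact: lulu_LL.
have UUE : U \o U = U by apply/funext => f; exact: lulu_UU.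
(* What follows is algebra from the five facts just established. *)
clearbody L U.
have LULE : L \o U \o L = UL.
  (* One inequality is L <= id at U (L f); the other is UL <= LU at L f, simplified by LL = L. *)
  apply/funext => f; apply/funext => x; apply/eqP; rewrite eq_le L_id /=.
  by have := ULLU (L f) x; rewrite (congr1 (@^~ f) LLE : L (L f) = L f).
have ULUE : U \o L \o U = LU.
  apply/funext => f; apply/funext => x; apply/eqP; rewrite eq_le U_id andbT.
  by have := ULLU (U f) x; rewrite (congr1 (@^~ f) UUE : U (U f) = U f).
have table : [/\ [/\ L  \o L = L,  L  \o U = LU, L  \o UL = UL & L  \o LU = LU],
    [/\ U  \o L = UL, U  \o U = U,  U  \o UL = UL & U  \o LU = LU],
    [/\ UL \o L = UL, UL \o U = LU, UL \o UL = UL & UL \o LU = LU] &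
    [/\ LU \o L = UL, LU \o U = LU, LU \o UL = UL & LU \o LU = LU] ].
  have LLU : L \o LU = LU by rewrite /LU compA LLE.
  have UUL : U \o UL = UL by rewrite /UL compA UUE.
  have LUL : L \o UL = UL by rewrite /UL compA.
  have ULU : U \o LU = LU by rewrite /LU compA.
  have ULL : UL \o L = UL by rewrite /UL -compA LLE.
  have LUU : LU \o U = LU by rewrite /LU -compA UUE.
  have ULUL : UL \o UL = UL by rewrite {1}/UL -compA LUL.
  have ULLUE : UL \o LU = LU by rewrite {1}/UL -compA LLU.
  have LUUL : LU \o UL = UL by rewrite {1}/LU -compA UUL.
  have LULU : LU \o LU = LU by rewrite {1}/LU -compA ULU.
  by split; split; (assumption || reflexivity).
have L_UL : (L <= UL)%O by apply/lefP => f; apply/lefP => x; exact: U_id.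
have UL_LU : (UL <= LU)%O by apply/lefP => f; apply/lefP => x; exact: ULLU.
have LU_U : (LU <= U)%O by apply/lefP => f; apply/lefP => x; exact: L_id.
have L_LU := le_trans L_UL UL_LU; have UL_U := le_trans UL_LU LU_U.
have L_U := le_trans L_UL UL_U.
have [SL SU SUL SLU] : [/\ S L, S U, S UL & S LU].
  by split; rewrite /S; [left; left; left|left; left; right|left; right|right].
split; first split.
- case: table => -[? ? ? ?] [? ? ? ?] [? ? ? ?] [? ? ? ?] P Q.
  move=> [[[->|->]|->]|->] [[[->|->]|->]|->]; cbv beta;
  match goal with e : ?X = _ |- S ?X => rewrite e; assumption end.
- by move=> P Q Q' _ _ _; rewrite compA.
split; first exact: table.
split; last by split.
move=> P Q [[[->|->]|->]|->] [[[->|->]|->]|->]; cbv beta;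
  first [left; assumption | right; assumption | left; exact: lexx].
Qed.
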